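(* (1) Let $s,q$ be integers with $s\ge1$ and $q\ge5$. Let $A$, $Q$, $H_{A,Q}$ be as in the context with $A\simeq\mathbb Z^s$ and $\mathfrak S(Q)\in\{\mathcal S_q,\mathcal A_q\}$. Then $H_{A,Q}$ is an infinite finitely generated non virtually solvable and non linear subgroup of $\mathrm{IET}$. (2) There exist infinitely many pairwise non isomorphic infinite finitely generated non virtually solvable and non linear subgroups of $\mathrm{IET}$.
   Context: An interval exchange transformation (iet) is a bijection $f:[0,1)\to[0,1)$ for which there is a finite partition of $[0,1)$ into half-open intervals $[a,b)$ on each of which $f$ is a translation. The iets form a group $\mathrm{IET}$ under composition. For $a\in\mathbb R/\mathbb Z$, $R_a\in\mathrm{IET}$ is the rotation $x\mapsto x+a \bmod 1$. For an integer $q\ge 1$ let $I_i=[\frac{i-1}{q},\frac{i}{q})$, $1\le i\le q$. For $\tau$ in the symmetric group $\mathcal S_q$ on $\{1,\dots,q\}$, $E_\tau$ is the iet that is a translation on each $I_i$ with $E_\tau(I_i)=I_{\tau(i)}$. Put $\mathcal G_{1/q}=\{E_\tau:\tau\in\mathcal S_q\}$; the map $\mathfrak S:\mathcal G_{1/q}\to\mathcal S_q$, $E_\tau\mapsto\tau$, is an isomorphism. $\mathcal A_q$ is the alternating group. Setup: $s,m,q\geq 1$ are integers; $\alpha_1,\dots,\alpha_s\in(\mathbb R/\mathbb Z)\setminus(\mathbb Q/\mathbb Z)$ are $\mathbb Q$-independent (i.e. $\sum n_i\alpha_i=0$ in $\mathbb R/\mathbb Z$ with $n_i\in\mathbb Z$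 forces all $n_i=0$; equivalently, for real representatives, $1,\alpha_1,\dots,\alpha_s$ are linearly independent over $\mathbb Q$); $A=\langle\alpha_1,\dots,\alpha_s\rangle\simeq\mathbb Z^s$ is the subgroup of $\mathbb R/\mathbb Z$ they generate; $g_1,\dots,g_m\in\mathcal G_{1/q}$ and $Q=\langle g_1,\dots,g_m\rangle\le\mathcal G_{1/q}$; and $H_{A,Q}=\langle R_{\alpha_1},\dots,R_{\alpha_s},g_1,\dots,g_m\rangle\le\mathrm{IET}$. A group is virtually solvable if it has a solvable subgroup of finite index. A linear group is a group isomorphic to a subgroup of $GL_n(K)$ for some $n$ and some field $K$. *)

(* Defs.v *)
From HB Require Import structures.
From mathcomp Require Import all_boot all_order all_algebra.
From mathcomp Require Import all_fingroup all_solvable ring_quotient.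
From mathcomp Require Import all_classical all_reals.
From mathcomp Require Import lra ring.

Set Implicit Arguments.
Unset Strict Implicit.
Unset Printing Implicit Defensive.

Import Order.TTheory GRing.Theory Num.Theory.

Local Open Scope classical_set_scope.
Local Open Scope group_scope.

(* Subgroups of a possibly infinite group [G : groupType] are classical sets  *)
(* [H : set G] such that [subgroup H].                                        *)
Section Groups.
Variable G : groupType.
Implicit Types H K S : set G.

Definition subgroup H : Prop := group_closed (mem H).

Definition gen S : set G := smallest subgroup S.

Definition finitely_generated H : Prop := exists s : seq G, H = gen [set` s].

Definition derived H : set G :=
  gen [set z | exists x y, [/\ H x, H y & z = [~ x, y]]].

Definition solvable_group H : Prop :=
  exists n : nat, iter n derived H `<=` [set 1].

Definition finite_index K H : Prop :=
  finite_set [set [set x * k | k in K] | x in H].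

Definition virtually_solvable H : Prop :=
  exists K, [/\ subgroup K, K `<=` H, finite_index K H & solvable_group K].

Lemma subgroupP H :
  subgroup H <-> H 1 /\ (forall x y, H x -> H y -> H (x * y^-1)).
Proof.
split=> [[/set_mem H1 HV]|[H1 HV]]; split => //.
- by move=> x y /mem_set Hx /mem_set Hy; apply: set_mem; exact: HV.
- exact: mem_set.
- by move=> x y /set_mem Hx /set_mem Hy; apply: mem_set; exact: HV.
Qed.

Lemma subgroup_gen S : subgroup (gen S).
Proof.
apply/subgroupP; split=> [K [/subgroupP[]] //|x y Hx Hy K KS].
have [/subgroupP[_ KV] _] := KS.
by apply: KV; [exact: Hx|exact: Hy].
Qed.

End Groups.

Definition isomorphic (G G' : groupType) (H : set G) (H' : set G') : Prop :=
  exists phi : G -> G', set_bij H H' phi /\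
    (forall x y, H x -> H y -> phi (x * y) = phi x * phi y).

(* The library's {'GL_n[F]} requires finite coefficients. *)
Section GeneralLinearGroup.
Variables (F : fieldType) (n : nat).

Record GL := MkGL { GL_mx :> 'M[F]_n; _ : GL_mx \in unitmx }.

HB.instance Definition _ := [isSub for GL_mx].
HB.instance Definition _ := [Choice of GL by <:].

Implicit Types A B C : GL.

Lemma GL_unit A : (A : 'M_n) \in unitmx. Proof. by case: A. Qed.

Fact GL_one_subproof : (1%:M : 'M[F]_n)%R \in unitmx.
Proof. exact: unitmx1. Qed.

Fact GL_mul_subproof A B : (A *m B)%R \in unitmx.
Proof. by rewrite unitmx_mul !GL_unit. Qed.

Fact GL_inv_subproof A : invmx A \in unitmx.
Proof. by rewrite unitmx_inv GL_unit. Qed.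

Definition GL_one := MkGL GL_one_subproof.
Definition GL_mul A B := MkGL (GL_mul_subproof A B).
Definition GL_inv A := MkGL (GL_inv_subproof A).

Fact GL_mulA : associative GL_mul.
Proof. by move=> A B C; apply: val_inj; exact: mulmxA. Qed.

Fact GL_mul1 : left_id GL_one GL_mul.
Proof. by move=> A; apply: val_inj; exact: mul1mx. Qed.

Fact GL_mulr1 : right_id GL_one GL_mul.
Proof. by move=> A; apply: val_inj; exact: mulmx1. Qed.

Fact GL_mulV : left_inverse GL_one GL_inv GL_mul.
Proof. by move=> A; apply: val_inj; exact: mulVmx (GL_unit A). Qed.

Fact GL_mulrV : right_inverse GL_one GL_inv GL_mul.
Proof. by move=> A; apply: val_inj; exact: mulmxV (GL_unit A). Qed.

HB.instance Definition _ :=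
  isGroup.Build GL GL_mulA GL_mul1 GL_mulr1 GL_mulV GL_mulrV.

End GeneralLinearGroup.

Definition linear_group (G : groupType) (H : set G) : Prop :=
  exists (n : nat) (F : fieldType) (L : set (GL F n)),
    subgroup L /\ isomorphic H L.

Local Close Scope group_scope.
Local Open Scope ring_scope.

(* The circle R/Z. *)
Definition Zint (R : realType) : zmodClosed R :=
  GRing.ZmodClosed.clone R (@Num.int_num_subdef R) _.

Definition circle (R : realType) := Quotient.quot (Zint R).
HB.instance Definition _ (R : realType) := GRing.Zmodule.on (circle R).
HB.instance Definition _ (R : realType) := EqQuotient.on (circle R).

Definition to_circle (R : realType) (x : R) : circle R :=
  (\pi_(circle R) x)%qT.

(* An element of R/Z is irrational when it lies outside Q/Z. *)
Definition irrational_mod1 (R : realType) (a : circle R) : Prop :=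
  forall r : rat, a <> to_circle (ratr r).

Definition Q_independent (R : realType) (s : nat) (alpha : 'I_s -> circle R) :
    Prop :=
  forall n : 'I_s -> int, \sum_(i < s) alpha i *~ n i = 0 ->
    forall i, n i = 0.

Lemma to_circle_eq (R : realType) (x y : R) :
  (to_circle x == to_circle y) = (x - y \is a Num.int).
Proof. by rewrite /to_circle -Quotient.idealrBE. Qed.

Lemma to_circleD (R : realType) (x y : R) :
  to_circle (x + y) = to_circle x + to_circle y.
Proof. exact: Quotient.pi_add. Qed.

Section IET.
Variable R : realType.

Definition ico := {x : R | 0 <= x < 1}.

Definition is_iet (f : ico -> ico) : Prop :=
  bijective f /\
  exists (n : nat) (a b c : 'I_n -> R),
    [/\ forall i, [/\ 0 <= a i, a i < b i & b i <= 1],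
        forall x : ico, exists! i, a i <= val x < b i
      & forall i (x : ico), a i <= val x < b i -> val (f x) = val x + c i].

Record iet := MkIet { iet_fun :> ico -> ico; _ : `[< is_iet iet_fun >] }.

HB.instance Definition _ := [isSub for iet_fun].
HB.instance Definition _ := [Choice of iet by <:].

Lemma ietP (f : iet) : is_iet f. Proof. by apply/asboolP; case: f. Qed.

Lemma iet_inj (f g : iet) : (forall x, f x = g x) -> f = g.
Proof. by move=> fg; apply: val_inj; apply/funext. Qed.

Lemma is_iet_pieces (I : finType) (a b c : I -> R) (f : ico -> ico) :
  bijective f ->
  (forall i, 0 <= a i /\ b i <= 1) ->
  (forall x : ico, exists! i, a i <= val x < b i) ->
  (forall i (x : ico), a i <= val x < b i -> val (f x) = val x + c i) ->
  is_iet f.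
Proof.
move=> bf ab part tr; split => //.
pose J : finType := {i | a i < b i}.
exists #|J|, (fun k => a (val (enum_val k))), (fun k => b (val (enum_val k))),
  (fun k => c (val (enum_val k))); split.
- by move=> k; have [? ?] := ab (val (enum_val k)); split => //;
  exact: (svalP (enum_val k)).
- move=> x; have [i [xi ui]] := part x.
  have abi : a i < b i by case/andP: xi => /le_lt_trans; apply.
  exists (enum_rank (exist _ i abi : J)); split; first by rewrite enum_rankK.
  move=> k xk; apply: enum_val_inj; rewrite enum_rankK; apply: val_inj => /=.
  exact: ui.
- by move=> k x; exact: tr.
Qed.

Lemma is_iet_id : is_iet id.
Proof.
apply: (@is_iet_pieces unit (fun=> 0) (fun=> 1) (fun=> 0)).
- by exists id.
- by [].
- by move=> x; exists tt; split; [exact: (valP x)|case].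
- by move=> _ x _; rewrite addr0.
Qed.

Lemma is_iet_comp f g : is_iet f -> is_iet g -> is_iet (f \o g).
Proof.
move=> [bf [n [a [b [c [abf pf tf]]]]]] [bg [m [a' [b' [c' [abg pg tg]]]]]].
pose A (k : 'I_m * 'I_n) := Num.max (a' k.1) (a k.2 - c' k.1).
pose B (k : 'I_m * 'I_n) := Num.min (b' k.1) (b k.2 - c' k.1).
have AB k (x : ico) : A k <= val x < B k =
    (a' k.1 <= val x < b' k.1) && (a k.2 <= val x + c' k.1 < b k.2).
  by rewrite ge_max lt_min lerBlDr ltrBrDr andbACA.
apply: (@is_iet_pieces _ A B (fun k => c' k.1 + c k.2)).
- exact: bij_comp.
- move=> k; have [a0 _ b1] := abg k.1.
  by rewrite le_max a0 /= ge_min b1.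
- move=> x; have [i [xi ui]] := pg x; have [j [xj uj]] := pf (g x).
  rewrite (tg _ _ xi) in xj uj.
  exists (i, j); split; first by rewrite AB; apply/andP.
  move=> [i' j']; rewrite AB => /andP[/ui/= ii'].
  by rewrite /= -ii' => /uj ->.
- move=> k x; rewrite AB => /andP[x1 x2] /=.
  by rewrite (tf k.2) ?(tg _ _ x1)// addrA.
Qed.

Lemma is_iet_inv f g : cancel f g -> cancel g f -> is_iet f -> is_iet g.
Proof.
move=> fK gK [_ [n [a [b [c [ab pf tf]]]]]].
have ico_piece i x : a i <= x < b i -> exists y : ico, val y = x.
  move=> /andP[ax xb]; have [a0 _ b1] := ab i.
  have x01 : 0 <= x < 1 by rewrite (le_trans a0 ax) (lt_le_trans xb b1).
  by exists (exist _ x x01).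
have back i (y : ico) : a i + c i <= val y < b i + c i ->
    a i <= val (g y) < b i /\ val (g y) = val y - c i.
  rewrite -lerBrDr -ltrBlDr => yi; have [x xE] := ico_piece i _ yi.
  rewrite -xE in yi; suff -> : g y = x by [].
  rewrite -[x]fK; congr g; apply: val_inj => /=.
  by rewrite (tf _ _ yi) xE subrK.
apply: (@is_iet_pieces _ (fun i => a i + c i) (fun i => b i + c i)
  (fun i => - c i)).
- by exists f.
- move=> i; have [a0 abi b1] := ab i.
  have [x xE] := ico_piece i (a i) ltac:(by rewrite lexx abi).
  split.
    rewrite -xE -(tf i x) ?xE ?lexx ?abi//.
    by have /andP[] := valP (f x).
  rewrite leNgt; apply/negP => bc1.
  have [z zE] := ico_piece i (Num.max (a i) (1 - c i))
    ltac:(by rewrite le_max lexx /= gt_max abi ltrBlDr).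
  have : val (f z) < 1 by have /andP[] := valP (f z).
  rewrite (tf i); last by rewrite zE le_max lexx /= gt_max abi ltrBlDr.
  by rewrite zE -ltrBrDr gt_max ltxx andbF.
- move=> y; have [i [yi ui]] := pf (g y); exists i; split.
    by rewrite -[y in val y]gK (tf _ _ yi) lerD2r ltrD2r.
  by move=> j /back[yj _]; exact: ui.
- by move=> i y /back[].
Qed.

Definition iet_one : iet := MkIet (asboolT is_iet_id).

Definition iet_mul (f g : iet) : iet :=
  MkIet (asboolT (is_iet_comp (ietP f) (ietP g))).

Fact iet_inv_subproof (f : iet) :
  {g : iet | cancel f g /\ cancel g f}.
Proof.
apply: cid; have [[g fK gK] _] := ietP f.
by exists (MkIet (asboolT (is_iet_inv fK gK (ietP f)))).
Qed.

Definition iet_inv (f : iet) : iet := sval (iet_inv_subproof f).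

Fact iet_mulA : associative iet_mul.
Proof. by move=> f g h; exact: iet_inj. Qed.

Fact iet_mul1 : left_id iet_one iet_mul.
Proof. by move=> f; exact: iet_inj. Qed.

Fact iet_mulr1 : right_id iet_one iet_mul.
Proof. by move=> f; exact: iet_inj. Qed.

Fact iet_mulV : left_inverse iet_one iet_inv iet_mul.
Proof.
move=> f; apply: iet_inj => x /=.
by have [fK _] := svalP (iet_inv_subproof f); exact: fK.
Qed.

Fact iet_mulrV : right_inverse iet_one iet_inv iet_mul.
Proof.
move=> f; apply: iet_inj => x /=.
by have [_ gK] := svalP (iet_inv_subproof f); exact: gK.
Qed.

HB.instance Definition _ :=
  isGroup.Build iet iet_mulA iet_mul1 iet_mulr1 iet_mulV iet_mulrV.

Definition frac (x : R) : R := x - (Num.floor x)%:~R.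

Lemma frac_ico x : 0 <= frac x < 1.
Proof. by rewrite subr_ge0 floor_le ltrBlDl -intrD1 floorD1_gt. Qed.

Lemma frac_uniq x y : 0 <= y < 1 -> x - y \is a Num.int -> frac x = y.
Proof.
move=> y01 /intrP[k xy]; rewrite /frac.
have -> : Num.floor x = k.
  by apply: floor_def; rewrite intrD -xy; lra.
by rewrite -xy opprB addrC subrK.
Qed.

Definition rot_fun (r : R) (x : ico) : ico :=
  exist _ (frac (val x + r)) (frac_ico _).

Lemma rot_funK r : cancel (rot_fun r) (rot_fun (- r)).
Proof.
move=> x; apply: val_inj => /=; apply: frac_uniq; first exact: (valP x).
have -> : frac (val x + r) - r - val x = - (Num.floor (val x + r))%:~R.
  by rewrite /frac; ring.
by rewrite rpredN intr_int.
Qed.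

Lemma is_iet_rot (r : R) : is_iet (rot_fun r).
Proof.
have /andP[t0 t1] := frac_ico r; set t := frac r in t0 t1.
have tE (x u : R) : t - u \is a Num.int -> 0 <= x + u < 1 ->
    frac (x + r) = x + u.
  move=> tu xu; apply: frac_uniq => //.
  have -> : x + r - (x + u) = (r - t) + (t - u) by ring.
  by rewrite rpredD// /t /frac opprB addrC subrK intr_int.
apply: (@is_iet_pieces bool (fun k => if k then 0 else 1 - t)
  (fun k => if k then 1 - t else 1) (fun k => if k then t else t - 1)).
- exists (rot_fun (- r)); first exact: rot_funK.
  by move=> x; rewrite -{1}(opprK r) rot_funK.
- by case; lra.
- move=> x; have := valP x => /= /andP[x0 x1].
  case: (ltP (val x) (1 - t)) => xt; [exists true|exists false].
  + by split; [rewrite x0 xt|case=> //; rewrite leNgt xt].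
  + by split; [rewrite x1 xt|case=> //; rewrite [_ < 1 - t]ltNge xt andbF].
- case=> x /= xi; apply: tE; have := valP x => /= ?.
  + by rewrite subrr rpred0.
  + by lra.
  + by rewrite opprB addrCA subrr addr0 rpred1.
  + by lra.
Qed.

Definition rotation (a : circle R) : iet :=
  MkIet (asboolT (is_iet_rot (generic_quotient.repr a))).

Lemma rotationE (r : R) (x : ico) :
  val (rotation (to_circle r) x) = frac (val x + r).
Proof.
rewrite /=; apply: frac_uniq; first exact: frac_ico.
set r' := generic_quotient.repr _.
have rr : r' - r \is a Num.int by rewrite -to_circle_eq /to_circle reprK.
have -> : val x + r' - frac (val x + r) =
    (r' - r) + (Num.floor (val x + r))%:~R by rewrite /frac; ring.
by rewrite rpredD ?intr_int.
Qed.

(* [piece q i] is I_(i+1): indices of pieces start at 0. *)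
Definition piece (q : nat) (i : 'I_q) : set R :=
  [set x | i%:R / q%:R <= x < i.+1%:R / q%:R].

(* The sum has exactly one term, given by the piece that contains x. *)
Definition shuffle_val (q : nat) (t : 'S_q) (x : R) : R :=
  x + \sum_(i < q | `[< piece i x >]) ((t i)%:R - i%:R) / q%:R.

Lemma piece_trans q (i j : 'I_q) x :
  piece i x -> piece j (x + (j%:R - i%:R) / q%:R).
Proof.
rewrite /piece /= -!natr1 => /andP[h1 h2]; apply/andP; split; lra.
Qed.

Lemma piece_uniq q (i j : 'I_q) (x : R) : piece i x -> piece j x -> i = j.
Proof.
rewrite /piece /= => /andP[i1 i2] /andP[j1 j2]; apply: val_inj.
have q0 : 0 < q%:R^-1 :> R.
  by rewrite invr_gt0 ltr0n; case: q i {i1 i2 j1 j2 j} => [[]|].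
have := le_lt_trans i1 j2; have := le_lt_trans j1 i2.
rewrite !ltr_pM2r// !ltr_nat !ltnS => ij ji.
by apply/eqP; rewrite eqn_leq ij ji.
Qed.

Lemma piece_sub q (i : 'I_q) x : piece i x -> 0 <= x < 1.
Proof.
rewrite /piece /= => /andP[i1 i2].
have q0 : 0 < q%:R :> R by rewrite ltr0n; case: q i {i1 i2} => [[]|].
rewrite (le_trans _ i1) ?divr_ge0//= (lt_le_trans i2)//.
by rewrite ler_pdivrMr// mul1r ler_nat ltn_ord.
Qed.

Lemma piece_ex q (x : R) : (0 < q)%N -> 0 <= x < 1 ->
  exists i : 'I_q, piece i x.
Proof.
move=> q0 /andP[x0 x1]; have q0' : 0 < q%:R :> R by rewrite ltr0n.
have /andP[k1 k2] : (Num.truncn (x * q%:R))%:R <= x * q%:R <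
    (Num.truncn (x * q%:R)).+1%:R.
  by apply: truncn_itv; rewrite mulr_ge0// ltW.
have kq : (Num.truncn (x * q%:R) < q)%N.
  rewrite -(ltr_nat R) (le_lt_trans k1)// -[ltRHS]mul1r ltr_pM2r//.
by exists (Ordinal kq); rewrite /piece /= ler_pdivrMr// ltr_pdivlMr// k1.
Qed.

Lemma shuffle_valE q (t : 'S_q) (i : 'I_q) x :
  piece i x -> shuffle_val t x = x + ((t i)%:R - i%:R) / q%:R.
Proof.
move=> xi; rewrite /shuffle_val (big_pred1 i)// => j /=.
by apply/asboolP/eqP => [/(piece_uniq xi)//|->].
Qed.

Lemma shuffle_val0 (t : 'S_0) x : shuffle_val t x = x.
Proof. by rewrite /shuffle_val big_ord0 addr0. Qed.

Lemma shuffle_val_ico q (t : 'S_q) (x : ico) : 0 <= shuffle_val t (val x) < 1.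
Proof.
case: q t => [|q] t; first by rewrite shuffle_val0 (valP x).
have [i xi] := piece_ex (ltn0Sn q) (valP x).
by rewrite (shuffle_valE _ xi); apply: piece_sub (piece_trans (t i) xi).
Qed.

Definition shuffle_fun q (t : 'S_q) (x : ico) : ico :=
  exist _ (shuffle_val t (val x)) (shuffle_val_ico t x).

Lemma shuffle_funK q (t : 'S_q) :
  cancel (shuffle_fun t) (shuffle_fun t^-1%g).
Proof.
move=> x; apply: val_inj => /=.
case: q t => [|q] t; first by rewrite !shuffle_val0.
have [i xi] := piece_ex (ltn0Sn q) (valP x).
rewrite (shuffle_valE t xi) (shuffle_valE _ (piece_trans (t i) xi)) permK.
by rewrite -addrA -mulrDl addrC subrKA subrr mul0r add0r.
Qed.

Lemma is_iet_shuffle q (t : 'S_q) : is_iet (shuffle_fun t).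
Proof.
case: q t => [|q] t.
  suff -> : shuffle_fun t = id by exact: is_iet_id.
  by apply/funext => x; apply: val_inj; rewrite /= shuffle_val0.
apply: (@is_iet_pieces _ (fun i : 'I_q.+1 => i%:R / q.+1%:R)
  (fun i => i.+1%:R / q.+1%:R) (fun i => ((t i)%:R - i%:R) / q.+1%:R)).
- exists (shuffle_fun t^-1%g); first exact: shuffle_funK.
  by move=> x; rewrite -{1}(invgK t) shuffle_funK.
- move=> i; split; first by rewrite divr_ge0.
  by rewrite ler_pdivrMr// mul1r ler_nat ltn_ord.
- move=> x; have [i xi] := piece_ex (ltn0Sn q) (valP x).
  by exists i; split => // j; exact: piece_uniq.
- by move=> i x xi /=; exact: shuffle_valE.
Qed.

(* E_t. Since permutations compose left to right in the library, t |-> E_t    *)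
(* reverses products; this does not affect subgroups.                         *)
Definition shuffle q (t : 'S_q) : iet := MkIet (asboolT (is_iet_shuffle t)).

Lemma shuffleM q (s t : 'S_q) : shuffle (s * t)%g = (shuffle t * shuffle s)%g.
Proof.
apply: iet_inj => x; apply: val_inj => /=.
case: q s t => [|q] s t; first by rewrite !shuffle_val0.
have [i xi] := piece_ex (ltn0Sn q) (valP x).
rewrite !(shuffle_valE _ xi) (shuffle_valE _ (piece_trans (s i) xi)) permM.
by rewrite -addrA -mulrDl addrC [_ - i%:R + _]addrC subrKA addrC.
Qed.

Lemma shuffle_inj q : injective (@shuffle q).
Proof.
move=> s t st; apply/permP => i.
have q0 : 0 < q%:R :> R by rewrite ltr0n; case: q i {s t st} => [[]|].
have xi : piece i (i%:R / q%:R).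
  by rewrite /piece /= lexx ltr_pM2r ?invr_gt0 ?ltr_nat /=.
pose x : ico := exist (fun x : R => is_true (0 <= x < 1)) _ (piece_sub xi).
have := congr1 (fun f : iet => val (f x)) st.
rewrite /= !(shuffle_valE _ xi) => /addrI /mulIf.
rewrite invr_eq0 gt_eqF// => /(_ isT) /addIr /eqP.
by rewrite eqr_nat => /eqP /val_inj.
Qed.

Definition shuffles (q : nat) : set iet := range (@shuffle q).

(* The image of Q under the isomorphism E_t |-> t. *)
Definition perms_of (q : nat) (Q : set iet) : set 'S_q :=
  [set t | Q (shuffle t)].

Definition Hgroup (s m : nat) (alpha : 'I_s -> circle R) (g : 'I_m -> iet) :
    set iet :=
  gen (range (fun i => rotation (alpha i)) `|` range g).

End IET.

Arguments perms_of {R} q Q.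

(* Main.v *)
Require Import Defs.
From mathcomp Require Import all_boot all_order all_algebra.
From mathcomp Require Import all_fingroup all_solvable.
From mathcomp Require Import all_classical all_reals.
From mathcomp Require Import lra ring zify.

Set Implicit Arguments.
Unset Strict Implicit.
Unset Printing Implicit Defensive.

Import Order.TTheory GRing.Theory Num.Theory.

Local Open Scope classical_set_scope.

(** Cut the circle into the fibres [{y + i/q}] over the points [y] of the base
    interval [[0, 1/q)]. A shuffle permutes every fibre in the same way. A
    rotation by [a] moves fibres to fibres, shifting indices cyclically when it
    passes the end of the base. So each element of [H] induces on the base,
    seen as a circle of length [1/q], a rotation, and those that induce the
    identity are families of permutations indexed by the base.

    Let [a] be a rotation of [H] with [0 < a < 1/q]. Conjugating a shuffle [t]
    by it gives the family equal to a cyclic conjugate of [t] below [a] and to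
    [t] above ([fibred_conj_rotation]). The commutator with [t] is supported on
    [[0, a)], and simplicity of the alternating group upgrades it to all
    alternating permutations there ([initial_layer]). By irrationality, [a] can
    be taken as small as wanted ([small_multiple_mod1]), so that for every [n]
    the multiples of [a] delimit [n] disjoint intervals over each of which [H]
    contains a copy of the alternating group ([layered_of_rotations]).

    These copies commute with one another and are not abelian, so a matrix
    representation of [H] would contain arbitrarily many linearly independent
    matrices of a fixed size ([commutator_free], [layered_not_linear]). A
    subgroup of finite index cannot separate the cosets of too many copies, and
    hence surjects onto the alternating group in some fibre
    ([layered_not_virtually_solvable]). A group that is not virtually solvable
    is infinite.

    For infinitely many isomorphism types, fix one irrational rotation and let
    all of the symmetric group of degree [q] act, for [q] prime. Elements of
    finite order act trivially on the base, so they permute each fibre of [q]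
    points: the group of degree [q] has elements of order [q], but none of
    larger prime order ([rotation_group_torsion],
    [rotation_group_no_torsion]). *)

(** * Subgroups of a group *)

Section Subgroups.
Local Open Scope group_scope.
Variables (G : groupType) (H : set G).
Hypothesis sH : subgroup H.

Lemma subgroup1 : H 1.
Proof. by case/subgroupP: sH. Qed.

Lemma subgroupV x : H x -> H x^-1.
Proof.
by move=> Hx; rewrite -[x^-1]mul1g; case/subgroupP: sH => H1; apply.
Qed.

Lemma subgroupM x y : H x -> H y -> H (x * y).
Proof.
move=> Hx /subgroupV Hy; rewrite -[y]invgK.
by case/subgroupP: sH => _; apply.
Qed.

Lemma subgroupR x y : H x -> H y -> H [~ x, y].
Proof.
by move=> Hx Hy; rewrite commgEl /conjg; do !apply: subgroupM => //;
  exact: subgroupV.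
Qed.

Lemma gen_min (S : set G) : S `<=` H -> gen S `<=` H.
Proof. by move=> SH x; apply. Qed.

End Subgroups.

Lemma sub_generated (G : groupType) (S : set G) : S `<=` gen S.
Proof. by move=> x Sx K [_]; apply. Qed.

Lemma subgroup_der (G : groupType) (H : set G) n :
  subgroup H -> subgroup (iter n (@derived G) H).
Proof. by case: n => [//|n] _ /=; exact: subgroup_gen. Qed.

(** * Permutations *)

Section Permutations.
Local Open Scope group_scope.

Definition cycle_perm q : 'S_q := perm (@ordS_inj q).

(** Witness: the 3-cycle on the letters [0], [1], [2], whose conjugate by the
    rotation of the letters is the 3-cycle on [1], [2], [3]; the two products
    differ at [0]. *)
Lemma alt_noncommuting q : (5 <= q)%N ->
  exists2 t : 'S_q, t \in 'Alt_('I_q) & ~ commute (t ^ cycle_perm q) t.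
Proof.
case: q => [|[|[|[|[|q]]]]] // _.
pose i0 : 'I_q.+4.+1 := ord0; pose i1 : 'I_q.+4.+1 := inord 1.
pose i2 : 'I_q.+4.+1 := inord 2.
have i0E : nat_of_ord i0 = 0%N by [].
have i1E : nat_of_ord i1 = 1%N by rewrite inordK.
have i2E : nat_of_ord i2 = 2%N by rewrite inordK.
have neq (i j : 'I_q.+4.+1) : i <> j :> nat -> (i == j) = false.
  by move=> ij; apply/negbTE/eqP => /(congr1 val).
have n01 := neq i0 i1 ltac:(by rewrite i0E i1E).
have n02 := neq i0 i2 ltac:(by rewrite i0E i2E).
have n12 := neq i1 i2 ltac:(by rewrite i1E i2E).
exists (tperm i0 i1 * tperm i0 i2).
  by rewrite Alt_even odd_permM !odd_tperm n01 n02.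
set t := (_ * _)%g.
have t0 : t i0 = i1 by rewrite permM tpermL tpermD ?n01 // eq_sym n12.
have t1 : t i1 = i2 by rewrite permM tpermR tpermL.
have s0 : cycle_perm q.+4.+1 i0 = i1.
  by rewrite permE; apply: val_inj; rewrite /= i1E modn_small.
have s1 : cycle_perm q.+4.+1 i1 = i2.
  by rewrite permE; apply: val_inj; rewrite /= i1E i2E modn_small.
have u1 : (t ^ cycle_perm q.+4.+1) i1 = i2.
  by rewrite -{1}s0 permJ t0 s1.
have u0 : (t ^ cycle_perm q.+4.+1) i0 = i0.
  (* [i0] is the image of the last letter, which [t] fixes. *)
  pose m : 'I_q.+4.+1 := inord q.+4.
  have mE : nat_of_ord m = q.+4 by rewrite inordK.
  have sm : cycle_perm q.+4.+1 m = i0.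
    by rewrite permE; apply: val_inj; rewrite /= mE modnn.
  have n0m := neq i0 m ltac:(by rewrite i0E mE).
  have n1m := neq i1 m ltac:(by rewrite i1E mE).
  have n2m := neq i2 m ltac:(by rewrite i2E mE).
  have tm : t m = m by rewrite permM !tpermD ?n0m ?n1m ?n2m.
  by rewrite -{1}sm permJ tm sm.
move=> /(congr1 (fun c : 'S_q.+4.+1 => c i0)).
by rewrite (permM _ t) (permM t) u0 t0 u1 => /eqP; rewrite n12.
Qed.

Lemma alt_conj q (t s : 'S_q) : t \in 'Alt_('I_q) -> t ^ s \in 'Alt_('I_q).
Proof.
move=> tA; rewrite memJ_norm //.
by rewrite (fintype.subsetP (normal_norm (Alt_normal _))) ?inE.
Qed.

Lemma alt_perfect q : (5 <= q)%N -> ('Alt_('I_q))^`(1) = 'Alt_('I_q).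
Proof.
move=> q5; have /simpleP[_ sA] : simple 'Alt_('I_q).
  by apply: simple_Alt5; rewrite card_ord.
have [/eqP|//] := sA [group of ('Alt_('I_q))^`(1)] (der_normal 1 _).
have [t tA tn] := alt_noncommuting q5.
move=> /eqP /derG1P /centsP /(_ (t ^ cycle_perm q) _ t tA) ct; case: tn.
by apply: ct; exact: alt_conj.
Qed.

End Permutations.

(** * Fibres *)

Section Fibres.
Local Open Scope group_scope.
Local Open Scope ring_scope.
Variables (R : realType) (q : nat).
Implicit Types (f g : iet R) (c d t : 'S_q) (y a b : R) (phi : R -> 'S_q).

(** The fibre over [y] consists of the [q] points [y + i/q]. Quantifying over
    the points of the circle with these values, rather than building them,
    lets products be handled without side conditions on [y]. *)
Definition fibre_action y f c : Prop :=
  forall (i : 'I_q) (x : ico R),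
    val x = y + i%:R / q%:R -> val (f x) = y + (c i)%:R / q%:R.

Definition fibred f phi : Prop :=
  forall y, 0 <= y < q%:R^-1 -> fibre_action y f (phi y).

Lemma fibre_ico y (i : 'I_q) : 0 <= y < q%:R^-1 -> 0 <= y + i%:R / q%:R < 1.
Proof.
have q0 : 0 < q%:R :> R by rewrite ltr0n; case: q i => [[]|].
move=> /andP[y0 y1]; rewrite addr_ge0 ?divr_ge0//=.
apply: (@lt_le_trans _ _ (q%:R^-1 + i%:R / q%:R)); first by rewrite ltrD2r.
by rewrite -[X in X + _]mul1r -mulrDl ler_pdivrMr // mul1r addrC natr1 ler_nat.
Qed.

Definition fibre_point y (hy : 0 <= y < q%:R^-1) (i : 'I_q) : ico R :=
  exist (fun x : R => is_true (0 <= x < 1)) _ (fibre_ico i hy).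

Lemma fibre_inj y (i j : 'I_q) :
  y + i%:R / q%:R = y + j%:R / q%:R -> i = j.
Proof.
have q0 : q%:R != 0 :> R by rewrite pnatr_eq0; case: q i {j} => [[]|].
move=> /addrI /(mulIf (invr_neq0 q0)) /eqP; rewrite eqr_nat => /eqP.
exact: val_inj.
Qed.

Lemma fibre_ex (x : ico R) : (0 < q)%N ->
  exists2 y, 0 <= y < q%:R^-1 & exists i : 'I_q, val x = y + i%:R / q%:R.
Proof.
move=> q0; have [i xi] := piece_ex q0 (valP x).
exists (val x - i%:R / q%:R); last by exists i; rewrite subrK.
move: xi; rewrite /piece /= => /andP[x1 x2].
by rewrite subr_ge0 x1 ltrBlDr -[X in X + _]mul1r -mulrDl addrC natr1.
Qed.

Lemma fibre_action1 y : fibre_action y 1%g 1%g.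
Proof. by move=> i x ->; rewrite perm1. Qed.

(** The order of the factors is reversed because permutations compose from left
    to right whereas interval exchanges compose as functions. *)
Lemma fibre_actionM y f g c d :
  fibre_action y f c -> fibre_action y g d -> fibre_action y (f * g)%g (d * c)%g.
Proof. by move=> fc gd i x xi; rewrite permM /=; apply/fc/gd. Qed.

Lemma iet_mulKV f (x : ico R) : f ((f^-1)%g x) = x.
Proof. by have /(congr1 (fun h : iet R => h x)) := mulgV f. Qed.

Lemma iet_mulVK f (x : ico R) : (f^-1)%g (f x) = x.
Proof. by have /(congr1 (fun h : iet R => h x)) := mulVg f. Qed.

Lemma fibre_actionV y f c :
  0 <= y < q%:R^-1 -> fibre_action y f c -> fibre_action y f^-1%g c^-1%g.
Proof.
move=> hy fc i x xi; have := fc ((c^-1)%g i) (fibre_point hy _) erefl.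
rewrite permKV -xi => /val_inj <-.
by rewrite iet_mulVK.
Qed.

Lemma fibre_action_uniq y f c d :
  0 <= y < q%:R^-1 -> fibre_action y f c -> fibre_action y f d -> c = d.
Proof.
move=> hy fc fd; apply/permP => i; apply: (@fibre_inj y).
by rewrite -(fc _ (fibre_point hy i) erefl) (fd _ (fibre_point hy i) erefl).
Qed.

Lemma fibre_actionR y f g c d : 0 <= y < q%:R^-1 ->
  fibre_action y f c -> fibre_action y g d ->
  fibre_action y [~ f, g] [~ d^-1, c^-1]%g.
Proof.
move=> hy fc gd.
have fV := fibre_actionV hy fc; have gV := fibre_actionV hy gd.
rewrite /commg /conjg !invgK.
have := fibre_actionM fV (fibre_actionM gV
  (fibre_actionM fc gd)).
by rewrite !mulgA.
Qed.

Lemma fibred_ext f phi psi :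
  fibred f phi -> (forall y, 0 <= y < q%:R^-1 -> phi y = psi y) -> fibred f psi.
Proof. by move=> fp pp y hy; rewrite -pp//; exact: fp. Qed.

(** The fibres over [[0, 1/q)] cover the circle, so their permutations determine
    the map. *)
Lemma fibred_inj f g phi : (0 < q)%N -> fibred f phi -> fibred g phi -> f = g.
Proof.
move=> q0 fp gp; apply: iet_inj => x; apply: val_inj.
have [y hy [i xi]] := fibre_ex x q0.
by rewrite (fp y hy i x xi) (gp y hy i x xi).
Qed.

Lemma fibredM f g phi psi : fibred f phi -> fibred g psi ->
  fibred (f * g)%g (fun y => psi y * phi y)%g.
Proof. by move=> fp gp y hy; apply: fibre_actionM; [exact: fp|exact: gp]. Qed.

Lemma fibredV f phi : fibred f phi -> fibred f^-1%g (fun y => (phi y)^-1%g).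
Proof. by move=> fp y hy; apply: fibre_actionV => //; exact: fp. Qed.

Lemma fibred1 : fibred 1%g (fun=> 1%g).
Proof. by move=> y _; exact: fibre_action1. Qed.

Lemma fibred_shuffle t : fibred (shuffle R t) (fun=> t).
Proof.
move=> y /andP[y0 y1] i x xi; rewrite /= (@shuffle_valE _ _ _ i).
  by rewrite xi mulrBl; ring.
rewrite /piece /= xi lerDr y0 -natr1 mulrDl mul1r.
by rewrite addrC ltrD2l y1.
Qed.

(** Going once around the circle shifts the index of the point in the fibre,
    so a rotation by a small [a] preserves indices unless [y + a] passes the
    end of the base interval. *)
Lemma rotation_fibre y a (i : 'I_q) (x : ico R) : 0 <= y + a < q%:R^-1 ->
  val x = y + i%:R / q%:R ->
  val (rotation (to_circle a) x) = (y + a) + i%:R / q%:R.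
Proof.
move=> hy xi; rewrite rotationE; apply: frac_uniq; first exact: fibre_ico.
rewrite xi; have -> : y + i%:R / q%:R + a - (y + a + i%:R / q%:R) = 0 by ring.
by rewrite rpred0.
Qed.

Lemma rotation_fibre_wrap y a (i : 'I_q) (x : ico R) :
  0 <= y + a - q%:R^-1 < q%:R^-1 ->
  val x = y + i%:R / q%:R ->
  val (rotation (to_circle a) x)
    = (y + a - q%:R^-1) + (cycle_perm q i)%:R / q%:R.
Proof.
move=> hy xi; rewrite rotationE; apply: frac_uniq; first exact: fibre_ico.
have q0 : q%:R != 0 :> R by rewrite pnatr_eq0; case: q i {hy xi} => [[]|].
rewrite xi permE /=.
have -> : y + i%:R / q%:R + a -
    (y + a - q%:R^-1 + (i.+1 %% q)%:R / q%:R) = (i.+1 %/ q)%:R.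
  have := congr1 (fun n => n%:R : R) (divn_eq i.+1 q).
  rewrite -natr1 natrD natrM => iE.
  have -> : i%:R = (i.+1 %/ q)%:R * q%:R + (i.+1 %% q)%:R - 1 :> R.
    by rewrite -iE addrK.
  by field.
by rewrite natr_int.
Qed.

(** The reason why conjugating by a small rotation yields something new: a fibre
    over [y < a] is carried back across the end of the base interval, which
    shifts the indices cyclically, whereas the other fibres keep their
    indices. *)
Lemma fibred_conj_rotation a f phi : 0 <= a < q%:R^-1 -> fibred f phi ->
  let r := rotation (to_circle a) in
  fibred (r * f * r^-1)%g
    (fun y => if y < a then phi (y - a + q%:R^-1) ^ cycle_perm q
              else phi (y - a))%g.
Proof.
move=> /andP[a0 a1] fp r y /andP[y0 y1] i x xi.
have conjE z : r z = x -> val ((r * f * r^-1)%g x) = val (r (f z)).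
  by move=> <-; rewrite -[RHS]/(val (r (f z))) -{2}(iet_mulVK r z).
case: ltP => ya.
  have hz : 0 <= y - a + q%:R^-1 < q%:R^-1 by lra.
  pose j := ((cycle_perm q)^-1 i)%g.
  pose z := fibre_point hz j.
  rewrite (conjE z); last first.
    apply: val_inj; rewrite (@rotation_fibre_wrap (y - a + q%:R^-1) a j) //;
      last by lra.
    by rewrite permKV xi; ring.
  rewrite (@rotation_fibre_wrap (y - a + q%:R^-1) a
    (phi (y - a + q%:R^-1) j)); last 2 first.
  - by lra.
  - by apply: fp.
  by rewrite /conjg !permM -/j; ring.
have hz : 0 <= y - a < q%:R^-1 by lra.
pose z := fibre_point hz i.
rewrite (conjE z); last first.
  by apply: val_inj; rewrite (@rotation_fibre (y - a) a i) //;
    [rewrite xi; ring|lra].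
rewrite (@rotation_fibre (y - a) a (phi (y - a) i)); last 2 first.
- by lra.
- by apply: fp.
by rewrite subrK.
Qed.

End Fibres.

(** * Layers *)

Section Layers.
Local Open Scope group_scope.
Local Open Scope ring_scope.
Variables (R : realType) (q : nat) (H : set (iet R)).
Hypotheses (q5 : (5 <= q)%N) (sH : subgroup H).
Hypothesis HA : forall t : 'S_q, (t \in 'Alt_('I_q))%g -> H (shuffle R t).
Implicit Types (c d t : 'S_q) (y a b : R).

(** The family of fibre permutations equal to [c] over [[a, b)] and trivial
    elsewhere. *)
Definition layer a b c : R -> 'S_q := fun y => if a <= y < b then c else 1%g.

(** The permutations [c] for which the layer over [[0, a)] belongs to [H] form a
    subgroup, normalized by the alternating group because the shuffles of
    alternating permutations act on all fibres alike. It is not trivial: for a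
    shuffle [t] and the rotation [r] by [a], the commutator of [r t r^-1] and [t]
    is trivial on the fibres over [y >= a], where both act by [t], and equals a
    commutator of [t ^ cycle_perm q] and [t] below [a]. Since the alternating
    group is simple, every alternating [c] is obtained. *)
Lemma initial_layer a c : 0 <= a < q%:R^-1 -> H (rotation (to_circle a)) ->
  (c \in 'Alt_('I_q))%g -> exists2 h, H h & fibred h (layer 0 a c).
Proof.
move=> /andP[a0 a1] Ha; set P := fun c => exists2 h, H h & fibred h (layer 0 a c).
rewrite -/(P c).
have layerE d y : 0 <= y < q%:R^-1 -> layer 0 a d y = if y < a then d else 1%g.
  by rewrite /layer => /andP[-> _].
have P1 : P 1%g.
  exists 1%g; first exact: subgroup1.
  by apply: (fibred_ext (@fibred1 R q)) => y _; rewrite /layer if_same.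
have PM d e : P d -> P e -> P (d * e)%g.
  move=> [h Hh hd] [k Hk ke]; exists (k * h)%g; first exact: subgroupM.
  apply: (fibred_ext (fibredM ke hd)) => y hy; rewrite /layer.
  by case: ifP; rewrite ?mulg1.
have PJ d t : (t \in 'Alt_('I_q))%g -> P d -> P (d ^ t)%g.
  move=> tA [h Hh hd].
  exists (shuffle R t * h * (shuffle R t)^-1)%g.
    apply: subgroupM => //; last by apply: subgroupV => //; exact: HA.
    by apply: subgroupM => //; exact: HA.
  apply: (fibred_ext (fibredM (fibredM (@fibred_shuffle R q t) hd)
    (fibredV (@fibred_shuffle R q t)))) => y hy.
  by rewrite /layer; case: ifP => _; rewrite ?conj1g /conjg ?mulgA ?mulg1 ?mulVg.
have [G GP] : exists G : {set 'S_q},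
    forall d, (d \in G) = (d \in 'Alt_('I_q))%g && `[< P d >].
  by exists [set d : 'S_q | (d \in 'Alt_('I_q))%g && `[< P d >]]%SET => d; rewrite finset.in_set.
have G_group : group_set G.
  apply/group_setP; split; first by rewrite GP group1; apply/asboolP.
  move=> d e; rewrite !GP => /andP[dA /asboolP Pd] /andP[eA /asboolP Pe].
  by rewrite groupM //; apply/asboolP; exact: PM.
have GA : (Group G_group <| 'Alt_('I_q))%g.
  apply/andP; split; first by apply/fintype.subsetP => d; rewrite GP => /andP[].
  apply/fintype.subsetP => t tA; rewrite inE.
  apply/fintype.subsetP => _ /imsetP[d dG ->].
  move: dG; rewrite !GP => /andP[dA /asboolP Pd]; rewrite groupJ //.
  by apply/asboolP; exact: PJ.
have [a_eq0|a_gt0] : a = 0 \/ 0 < a by case: (ltgtP 0 a) a0 => // *; [right|left].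
  move=> _; exists 1%g; first exact: subgroup1.
  apply: (fibred_ext (@fibred1 R q)) => y hy; rewrite layerE// a_eq0 ltNge.
  by case/andP: hy => ->.
have /simpleP[_ sA] : simple 'Alt_('I_q).
  by apply: simple_Alt5; rewrite card_ord.
case: (sA _ GA) => [G1|GE]; last first.
  by have : G = 'Alt_('I_q)%g by [rewrite -[LHS]/(gval (Group G_group)) GE];
    move=> <-; rewrite GP => /andP[_ /asboolP].
have [t tA tn] := alt_noncommuting q5; case: tn.
have sA' := alt_conj (cycle_perm q) tA.
pose d := [~ t^-1, (t ^ cycle_perm q)^-1]%g.
suff : d \in G.
  have -> : G = 1%g by rewrite -[LHS]/(gval (Group G_group)) G1.
  move=> /set1gP/eqP/commgP /(congr1 (fun x => x^-1)%g).
  by rewrite !invMg !invgK.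
rewrite GP groupR ?groupV//=; apply/asboolP.
pose r := rotation (to_circle a).
exists [~ r * shuffle R t * r^-1, shuffle R t]%g.
  have Ht := HA tA; apply: subgroupR => //.
  by do !apply: subgroupM => //; exact: subgroupV.
move=> y hy; rewrite layerE//.
have a01 : 0 <= a < q%:R^-1 by rewrite a0.
have := fibre_actionR hy (fibred_conj_rotation a01 (@fibred_shuffle R q t) hy)
   (@fibred_shuffle R q t _ hy).
by case: ifP => // _; rewrite commgg.
Qed.

Lemma layer_ex a b c : 0 <= a -> a < b -> b < q%:R^-1 ->
  H (rotation (to_circle a)) -> H (rotation (to_circle b)) ->
  (c \in 'Alt_('I_q))%g -> exists2 h, H h & fibred h (layer a b c).
Proof.
move=> a0 ab b1 Ha Hb cA.
have [|h Hh hc] := @initial_layer b c _ Hb cA; first by lra.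
have [|k Hk kc] := @initial_layer a c _ Ha cA; first by lra.
(* The layers over [[0, a)] cancel. *)
exists (k^-1 * h)%g; first by apply: subgroupM => //; exact: subgroupV.
apply: (fibred_ext (fibredM (fibredV kc) hc)) => y /andP[y0 _].
rewrite /layer y0 /=; case: (ltP y a) => ya.
  by rewrite (lt_trans ya ab) mulgV.
by rewrite invg1 mulg1.
Qed.

End Layers.

(** * Small rotations *)

Section SmallRotations.
Local Open Scope ring_scope.
Variables (R : realType) (r : R).
Hypothesis r_irr : forall k : int, r * k%:~R \is a Num.int -> k = 0.

(** Dirichlet: among the fractional parts of [r * k] for [k <= n], two fall in the
    same interval of length [1/n]. *)
Lemma small_multiple_mod1 n : (0 < n)%N ->
  exists k : int, exists2 a, 0 < a < n%:R^-1 & to_circle a = to_circle (r * k%:~R).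
Proof.
move=> n0.
have /choice[f fP] (k : 'I_n.+1) :
    exists i : 'I_n, piece i (Defs.frac (r * k%:R)).
  by apply: piece_ex => //; exact: Defs.frac_ico.
have /injectivePn[k [l kl fkl]] : ~~ injectiveb f.
  by apply/negP => /injectiveP/leq_card; rewrite !card_ord ltnn.
pose d := Defs.frac (r * k%:R) - Defs.frac (r * l%:R).
have d_circle : to_circle d = to_circle (r * (k%:Z - l%:Z)%:~R).
  apply/eqP; rewrite to_circle_eq /d /Defs.frac intrB.
  rewrite (_ : _ - _ = (Num.floor (r * l%:R) - Num.floor (r * k%:R))%:~R).
    by rewrite intr_int.
  by rewrite intrB; ring.
have d_small : - n%:R^-1 < d < n%:R^-1.
  have := fP k; have := fP l; rewrite fkl /piece /= -natr1 mulrDl mul1r /d.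
  by move=> /andP[? ?] /andP[? ?]; apply/andP; split; lra.
have d_neq0 : d != 0.
  apply: contra_neq kl => d0; move: d_circle => /esym/eqP.
  rewrite d0 to_circle_eq subr0 => /r_irr /eqP; rewrite subr_eq0 eqz_nat => /eqP.
  exact: val_inj.
have [d_gt0|d_lt0|d_eq0] := ltgtP 0 d; last by rewrite -d_eq0 eqxx in d_neq0.
  by exists (k%:Z - l%:Z), d => //; lra.
exists (l%:Z - k%:Z), (- d); first by lra.
apply/eqP; rewrite to_circle_eq.
move/eqP: d_circle; rewrite to_circle_eq -rpredN.
by rewrite (_ : - (d - _) = - d - r * (l%:Z - k%:Z)%:~R) // !intrB; ring.
Qed.

End SmallRotations.

Section LayeredGroups.
Local Open Scope ring_scope.
Variables (R : realType) (q : nat).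
Implicit Types H : set (iet R).

(** Arbitrarily many disjoint consecutive intervals of the base over each of
    which all alternating permutations are realized in [H] independently. This
    is all that the non-linearity and the failure of virtual solvability use. *)
Definition layered H : Prop := forall n,
  exists2 a : R, 0 < a /\ n%:R * a < q%:R^-1 &
  forall i c, (i < n)%N -> (c \in 'Alt_('I_q))%g ->
    exists2 h, H h & fibred h (layer (i%:R * a) (i.+1%:R * a) c).

(** The multiples [i * a] of a single small rotation [a] of [H] serve as the ends
    of all the intervals. *)
Lemma layered_of_rotations (r : R) H : (5 <= q)%N -> subgroup H ->
  (forall t : 'S_q, (t \in 'Alt_('I_q))%g -> H (shuffle R t)) ->
  (forall k : int, r * k%:~R \is a Num.int -> k = 0) ->
  (forall k : int, H (rotation (to_circle (r * k%:~R)))) ->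
  layered H.
Proof.
move=> q5 sH HA r_irr Hr n.
have q0 : (0 < q)%N by lia.
(* All [n] intervals fit in the base because [a < 1/(q (n + 1))]. *)
have qn0 : (0 < q * n.+1)%N by rewrite muln_gt0 q0.
have [k [a /andP[a0 a1] ak]] := small_multiple_mod1 r_irr qn0.
have na : n%:R * a < q%:R^-1.
  apply: (@lt_le_trans _ _ (n.+1%:R * a)); first by rewrite ltr_pM2r ?ltr_nat.
  rewrite mulrC -ler_pdivlMr ?ltr0n // -invfM -natrM; exact: ltW.
exists a => // i c i_n cA.
have Hia j : H (rotation (to_circle (j%:R * a))).
  suff -> : to_circle (j%:R * a) = to_circle (r * (k * j%:Z)%:~R) by [].
  apply/eqP; rewrite to_circle_eq intrM.
  rewrite (_ : _ - _ = j%:R * (a - r * k%:~R)); last by ring.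
  by rewrite rpredM ?natr_int // -to_circle_eq ak.
apply: layer_ex => //.
- by rewrite mulr_ge0 // ltW.
- by rewrite ltr_pM2r // ltr_nat.
- by apply: le_lt_trans na; rewrite ler_pM2r // ler_nat.
Qed.

Lemma layer_step (a : R) (c : 'S_q) i j : 0 < a ->
  layer (i%:R * a) (i.+1%:R * a) c (j%:R * a) = if i == j then c else 1%g.
Proof.
move=> a0; rewrite /layer ler_pM2r // ltr_pM2r // ler_nat ltr_nat ltnS.
by rewrite eqn_leq.
Qed.

Lemma layer_disjoint (a y : R) (c d : 'S_q) i j : 0 < a -> i != j ->
  commute (layer (i%:R * a) (i.+1%:R * a) c y) (layer (j%:R * a) (j.+1%:R * a) d y).
Proof.
move=> a0 ij; rewrite /layer; case: ifP => [/andP[i1 i2]|_];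
  last exact: commute_sym (commute1 _).
case: ifP => [/andP[j1 j2]|_]; last exact: commute1.
have := le_lt_trans i1 j2; have := le_lt_trans j1 i2.
rewrite !ltr_pM2r // !ltr_nat !ltnS => ji' ij'.
by case/eqP: ij; apply/eqP; rewrite eqn_leq ji' ij'.
Qed.

End LayeredGroups.

(** * Groups with many commuting non-abelian pieces *)

Section Linear.
Local Open Scope ring_scope.

(** The [X i] are linearly independent: taking the commutator of a linear
    relation with [Y j] kills every term but the [j]-th. *)
Lemma commutator_free (F : fieldType) d n (X Y : 'I_n -> 'M[F]_d) :
  (forall i j, X i *m Y j = Y j *m X i <-> i != j) -> (n <= d * d)%N.
Proof.
move=> XY; pose A : 'M[F]_(n, d * d) := \matrix_i mxvec (X i).
suff /eqP <- : row_free A by exact: rank_leq_col.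
apply: inj_row_free => v vA.
have lin0 : \sum_i v 0 i *: X i = 0.
  apply/(can_inj mxvecK); rewrite linear_sum linear0 -[RHS]vA mulmx_sum_row.
  by apply: eq_bigr => i _; rewrite rowK linearZ.
apply/rowP => j; rewrite mxE.
have := congr1 (fun M => M *m Y j - Y j *m M) lin0.
rewrite mul0mx mulmx0 subrr mulmx_suml mulmx_sumr -sumrB (bigD1 j) //= big1.
  rewrite addr0 -scalemxAl -scalemxAr -scalerBr => /eqP; rewrite scaler_eq0.
  by case/orP => [/eqP//|]; rewrite subr_eq0 => /eqP/XY; rewrite eqxx.
by move=> i ij; rewrite -scalemxAl -scalemxAr (XY i j).2 ?subrr.
Qed.

(** A bound on the number of such pairs that depends only on the dimension rules
    out a linear representation over any field, in any characteristic. *)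
Lemma not_linear (G : groupType) (H : set G) : subgroup H ->
  (forall n, exists x y : 'I_n -> G,
     [/\ forall i, H (x i), forall i, H (y i) &
         forall i j, commute (x i) (y j) <-> i != j]) ->
  ~ linear_group H.
Proof.
move=> sH Hpairs [d [F [L [_ [phi [[phiL phi_inj _] phiM]]]]]].
have [x [y [Hx Hy xy]]] := Hpairs (d * d).+1.
suff : ((d * d).+1 <= d * d)%N by rewrite ltnn.
apply: (@commutator_free F d _ (fun i => phi (x i)) (fun i => phi (y i))) => i j.
rewrite -xy; split=> e; last first.
  by have := congr1 (fun z => val (phi z)) e; rewrite !phiM.
apply: phi_inj; rewrite ?inE; [exact: subgroupM|exact: subgroupM|].
by rewrite !phiM //; exact: val_inj.
Qed.

End Linear.

Section NotVirtuallySolvable.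
Local Open Scope ring_scope.
Variables (R : realType) (q : nat).
Hypothesis q5 : (5 <= q)%N.
Implicit Types H K : set (iet R).

Lemma layer_bottom_in_base (a : R) n i : 0 < a -> n%:R * a < q%:R^-1 -> (i < n)%N ->
  0 <= i%:R * a < q%:R^-1.
Proof.
move=> a0 na i_n; apply/andP; split; first by rewrite mulr_ge0 // ltW.
by apply: le_lt_trans na; rewrite ler_pM2r // ler_nat ltnW.
Qed.

Lemma layered_not_linear H : subgroup H -> layered q H -> ~ linear_group H.
Proof.
move=> sH HL; apply: not_linear => // n; have [a [a0 na] La] := HL n.
have [t tA tn] := alt_noncommuting q5.
have sA := alt_conj (cycle_perm q) tA.
(* The pairs are the layers of the two non-commuting permutations. *)
have fam c : (c \in 'Alt_('I_q))%g -> {x : 'I_n -> iet R & forall i, H (x i) /\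
    fibred (x i) (layer (i%:R * a) (i.+1%:R * a) c)}.
  move=> cA; apply: (@choice _ _ (fun (i : 'I_n) x => H x /\
    fibred x (layer (i%:R * a) (i.+1%:R * a) c))) => i.
  by have [h Hh hc] := La i c (ltn_ord i) cA; exists h.
have [x xP] := fam _ tA; have [y yP] := fam _ sA.
exists x, y; split=> [i|i|i j]; [by case: (xP i)|by case: (yP i)|].
have [_ xi] := xP i; have [_ yj] := yP j.
have xy := fibredM xi yj; have yx := fibredM yj xi.
split=> [e|ij]; last first.
  apply: (@fibred_inj _ q _ _ _ _ xy); first by lia.
  apply: (fibred_ext yx) => u _; apply: layer_disjoint => //.
apply/negP => /eqP ij; apply: tn; subst j; rewrite e in xy.
have hia := layer_bottom_in_base a0 na (ltn_ord i).
have := fibre_action_uniq hia (xy _ hia) (yx _ hia).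
by rewrite !layer_step // eqxx.
Qed.

(** Surjecting onto the alternating group in a fibre passes to derived subgroups
    because the alternating group is perfect. *)
Lemma derived_fibre_action K (y : R) n : subgroup K -> 0 <= y < q%:R^-1 ->
  (forall c, (c \in 'Alt_('I_q))%g -> exists2 k, K k & fibre_action y k c) ->
  forall c, (c \in 'Alt_('I_q))%g ->
    exists2 k, iter n (@derived _) K k & fibre_action y k c.
Proof.
move=> sK hy KA; elim: n => [//|n IHn] c; rewrite -{1}(alt_perfect q5).
set D := iter n _ K in IHn *; have sD := @subgroup_der _ K n sK.
pose P (c : 'S_q) := exists2 k, derived D k & fibre_action y k c.
have [G GP] : exists G : {set 'S_q}, forall d, (d \in G) = `[< P d >].
  by exists [set d | `[< P d >]]%SET => d; rewrite finset.in_set.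
have sG : group_set G.
  apply/group_setP; split.
    rewrite GP; apply/asboolP; exists 1%g; last exact: fibre_action1.
    exact: subgroup1 (subgroup_gen _).
  move=> d e; rewrite !GP => /asboolP[h Hh hd] /asboolP[k Kk ke].
  apply/asboolP; exists (k * h)%g; last exact: fibre_actionM.
  exact: subgroupM (subgroup_gen _) _ _ Kk Hh.
suff /fintype.subsetP /[apply] : (('Alt_('I_q))^`(1) \subset Group sG)%g.
  by rewrite GP => /asboolP.
rewrite gen_subG; apply/fintype.subsetP => _ /imset2P[d e dA eA ->].
rewrite GP; apply/asboolP.
have [h Hh hd] := IHn _ (groupVr eA); have [k Kk ke] := IHn _ (groupVr dA).
exists [~ h, k]%g; first by apply: sub_generated; exists h, k.
by have := fibre_actionR hy hd ke; rewrite !invgK.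
Qed.

Lemma finite_range_repeat (T : choiceType) (A : set T) :
  finite_set A -> exists n, forall F : 'I_n -> 'S_q -> T,
    (forall i c, A (F i c)) -> exists i j, i != j /\ F i =1 F j.
Proof.
move=> /finite_seqP[s ->].
exists #|{ffun 'S_q -> 'I_(size s).+1}|.+1 => F Fs.
pose code i := [ffun c => Ordinal (index_size (F i c) s : (_ < (size s).+1)%N)].
have /injectivePn[i [j ij cij]] : ~~ injectiveb code.
  by apply/negP => /injectiveP/leq_card; rewrite card_ord ltnn.
exists i, j; split=> // c.
have /(congr1 val) /= := congr1 (fun f : {ffun _ -> _} => f c) cij.
rewrite !ffunE /= => /(congr1 (nth (F i c) s)).
by rewrite !nth_index //; exact: Fs.
Qed.

(** With more layers than there are maps from permutations to cosets of [K],
    two layers [i != j] have their elements [e i c] and [e j c] in the same coset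
    for every [c]. The quotients [(e i c)^-1 * e j c] then lie in [K] and act by
    [c] on a fibre of the layer [j], so that [K] surjects onto the alternating
    group there. *)
Lemma layered_not_virtually_solvable H :
  subgroup H -> layered q H -> ~ virtually_solvable H.
Proof.
move=> sH HL [K [sK KH Kfin [d Kd]]].
have [n pigeon] := finite_range_repeat Kfin; have [a [a0 na] La] := HL n.
have [e eP] : exists e : 'I_n -> 'S_q -> iet R, forall i c, H (e i c) /\
    ((c \in 'Alt_('I_q))%g ->
     fibred (e i c) (layer (i%:R * a) (i.+1%:R * a) c)).
  have /choice[e eP] (ic : 'I_n * 'S_q) : exists h, H h /\
      ((ic.2 \in 'Alt_('I_q))%g ->
       fibred h (layer (ic.1%:R * a) (ic.1.+1%:R * a) ic.2)).
    case: (boolP (ic.2 \in 'Alt_('I_q))%g) => [cA|_].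
      by have [h] := La _ _ (ltn_ord ic.1) cA; exists h.
    by exists 1%g; split => //; exact: subgroup1.
  by exists (fun i c => e (i, c)) => i c; exact: (eP (i, c)).
have [i [j [ij eij]]] :=
  pigeon (fun i c => [set (e i c * k)%g | k in K])
         (fun i c => ex_intro2 _ _ (e i c) (eP i c).1 erefl).
pose y : R := j%:R * a.
have hy : 0 <= y < q%:R^-1 := layer_bottom_in_base a0 na (ltn_ord j).
have KA c : (c \in 'Alt_('I_q))%g -> exists2 k, K k & fibre_action y k c.
  move=> cA; have [k Kk ek] : [set (e i c * k)%g | k in K] (e j c).
    by rewrite eij; exists 1%g; [exact: subgroup1|rewrite mulg1].
  exists k => //; have -> : k = ((e i c)^-1 * e j c)%g by rewrite -ek mulKg.
  have := fibredM (fibredV ((eP i c).2 cA)) ((eP j c).2 cA) hy.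
  by rewrite !layer_step // eqxx (negbTE ij : (i == j :> nat) = false) invg1 mulg1.
have [t tA tn] := alt_noncommuting q5; case: tn.
have [k /Kd k1] := derived_fibre_action d sK hy KA tA.
move: (k1 : k = 1%g) => -> t1.
rewrite (fibre_action_uniq hy t1 (@fibre_action1 R q y)); exact: commute1.
Qed.

End NotVirtuallySolvable.

(** In a finite group the trivial subgroup has finite index. *)
Lemma not_virtually_solvable_infinite (G : groupType) (H : set G) :
  subgroup H -> ~ virtually_solvable H -> infinite_set H.
Proof.
move=> sH HV Hfin; apply: HV; exists [set 1%g]; split.
- by apply/subgroupP; split=> // x y -> ->; rewrite mulgV.
- by move=> _ ->; exact: subgroup1.
- exact: finite_image.
- by exists 0%N.
Qed.

(** * The groups generated by rotations and shuffles *)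

Section RotationGroups.
Local Open Scope ring_scope.
Variable R : realType.
Implicit Types (H : set (iet R)) (r : R).

Lemma rotationD (x y : R) :
  rotation (to_circle (x + y)) = (rotation (to_circle x) * rotation (to_circle y))%g.
Proof.
apply: iet_inj => u; apply: val_inj; rewrite rotationE; apply: frac_uniq.
  exact: (valP (rotation (to_circle x) (rotation (to_circle y) u))).
rewrite -[X in _ - X]/(val (rotation (to_circle x) (rotation (to_circle y) u))).
rewrite !rotationE /Defs.frac.
set m := Num.floor (_ + y); set n := Num.floor (_ + x).
rewrite (_ : _ - _ = (m + n)%:~R) ?intr_int // intrD; ring.
Qed.

Lemma rotation0 : rotation (to_circle (0 : R)) = 1%g.
Proof.
by apply: (mulgI (rotation (to_circle 0))); rewrite -rotationD addr0 mulg1.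
Qed.

Lemma rotationN (x : R) : rotation (to_circle (- x)) = (rotation (to_circle x))^-1%g.
Proof.
by apply: (mulgI (rotation (to_circle x))); rewrite -rotationD subrr rotation0 mulgV.
Qed.

Lemma rotation_multiples H r (k : int) : subgroup H ->
  H (rotation (to_circle r)) -> H (rotation (to_circle (r * k%:~R))).
Proof.
move=> sH Hr.
have Hn (n : nat) : H (rotation (to_circle (r * n%:R))).
  elim: n => [|n IHn]; first by rewrite mulr0 rotation0; exact: subgroup1.
  by rewrite -natr1 mulrDr mulr1 rotationD; exact: subgroupM.
case: k => n; first exact: Hn.
by rewrite NegzE intrN mulrN rotationN; apply: subgroupV => //; exact: Hn.
Qed.

Lemma irrational_mod1_multiple (a : circle R) : irrational_mod1 a ->
  exists2 r, a = to_circle r & forall k : int, r * k%:~R \is a Num.int -> k = 0.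
Proof.
move=> a_irr; have ar : a = to_circle (generic_quotient.repr a).
  by rewrite /to_circle reprK.
exists (generic_quotient.repr a) => // k; set r := generic_quotient.repr a in ar *.
move=> /intrP[z rk]; apply/eqP/negPn/negP => k0; apply: (a_irr (z%:~R / k%:~R)).
rewrite ar; congr to_circle; rewrite fmorph_div /= !ratr_int -rk mulfK //.
by rewrite intr_eq0.
Qed.

Lemma multiple_irrational_mod1 r :
  (forall k : int, r * k%:~R \is a Num.int -> k = 0) ->
  irrational_mod1 (to_circle r).
Proof.
move=> r_irr x /eqP; rewrite to_circle_eq => rx.
suff /r_irr/eqP : r * (denq x)%:~R \is a Num.int by rewrite (negbTE (denq_neq0 x)).
have -> : r * (denq x)%:~R = (r - ratr x) * (denq x)%:~R + (numq x)%:~R.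
  by rewrite mulrBl /ratr divfK ?subrK // intr_eq0.
by rewrite rpredD ?rpredM ?intr_int.
Qed.

(** The square root of 2, by the parity of the 2-adic valuation. *)
Lemma irrational_ex : exists r, forall k : int, r * k%:~R \is a Num.int -> k = 0.
Proof.
exists (Num.sqrt 2) => k /intrP[z rk]; apply/eqP/negPn/negP => k0.
have : 2 * (k * k) = z * z.
  apply: (@intr_inj R); rewrite !intrM -rk.
  by rewrite [RHS]mulrACA; congr (_ * _); rewrite -expr2 sqr_sqrtr.
move=> /(congr1 absz); rewrite !abszM => kz.
have k0' : (0 < `|k|)%N by rewrite absz_gt0.
have z0 : (0 < `|z|)%N by case: `|z|%N kz => //; lia.
have := congr1 (logn 2) kz; rewrite !lognM //; last by rewrite muln_gt0 k0'.
by rewrite (@logn_prime 2 2) //= => /(congr1 odd); rewrite !oddD !addbb.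
Qed.

Section Hgroups.
Variables (s m q : nat) (alpha : 'I_s -> circle R) (g : 'I_m -> iet R).

Lemma Hgroup_properties : (0 < s)%N -> (5 <= q)%N ->
  (forall i, irrational_mod1 (alpha i)) ->
  (forall t : 'S_q, (t \in 'Alt_('I_q))%g -> gen (range g) (shuffle R t)) ->
  let H := Hgroup alpha g in
  [/\ subgroup H, infinite_set H, finitely_generated H,
      ~ virtually_solvable H & ~ linear_group H].
Proof.
move=> s0 q5 irr gA H; have sH : subgroup H by exact: subgroup_gen.
have gH : gen (range g) `<=` H.
  by apply: gen_min => // x gx; apply: sub_generated; right.
have [r ar r_irr] := irrational_mod1_multiple (irr (Ordinal s0)).
have HL : layered q H.
  apply: (layered_of_rotations q5 sH _ r_irr) => [t tA|k].
    exact: (gH _ (gA t tA)).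
  apply: (rotation_multiples _ sH); rewrite -ar.
  by apply: sub_generated; left; exists (Ordinal s0).
have HV := layered_not_virtually_solvable q5 sH HL.
split=> //; last exact: layered_not_linear HL.
  exact: not_virtually_solvable_infinite.
exists ([seq rotation (alpha i) | i <- enum 'I_s] ++ [seq g j | j <- enum 'I_m]).
congr gen; apply/seteqP; split=> x /=; rewrite mem_cat.
  by case=> [[i _ <-]|[j _ <-]]; apply/orP; [left|right]; apply/map_f;
    rewrite mem_enum.
case/orP => /mapP[i _ ->]; [left|right]; by exists i.
Qed.

End Hgroups.
End RotationGroups.

(** * Torsion *)

Section Isomorphism.
Local Open Scope group_scope.

Definition has_torsion (G : groupType) n (H : set G) : Prop :=
  exists u, [/\ H u, u <> 1 & u ^+ n = 1].

Lemma isomorphic_refl (G : groupType) (H : set G) : isomorphic H H.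
Proof.
by exists id; split=> //; split=> [x Hx //|x y _ _ //|x Hx]; exists x.
Qed.

Lemma isomorphic_torsion (G G' : groupType) n (H : set G) (H' : set G') :
  subgroup H -> isomorphic H H' -> has_torsion n H <-> has_torsion n H'.
Proof.
move=> sH [phi [[phiH phi_inj phi_surj] phiM]].
have H1 := subgroup1 sH.
have phi1 : phi 1 = 1.
  by apply: (mulgI (phi 1)); rewrite -phiM // !mulg1.
have HX u k : H u -> H (u ^+ k).
  by move=> Hu; elim: k => [|k IHk]; rewrite ?expg0 // expgS; exact: subgroupM.
have phiX u k : H u -> phi (u ^+ k) = phi u ^+ k.
  move=> Hu; elim: k => [|k IHk]; first by rewrite !expg0.
  by rewrite !expgS phiM ?IHk //; exact: HX.
split=> [[u [Hu u1 un]]|[v [Hv v1 vn]]].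
  exists (phi u); split; first exact: phiH.
    by move=> pu; apply: u1; apply: phi_inj; rewrite ?inE // pu phi1.
  by rewrite -phiX // un phi1.
have [u Hu uv] := phi_surj v Hv; exists u; split=> //.
  by move=> u1; apply: v1; rewrite -uv u1 phi1.
by apply: phi_inj; rewrite ?inE //; [exact: HX|rewrite phiX // uv vn phi1].
Qed.

End Isomorphism.

Section Torsion.
Local Open Scope group_scope.
Local Open Scope ring_scope.
Variables (R : realType) (r : R).
Hypothesis r_irr : forall k : int, r * k%:~R \is a Num.int -> k = 0.

Definition rotation_group q : set (iet R) :=
  Hgroup (fun _ : 'I_1 => to_circle r)
         (fun j : 'I_#|{: 'S_q}| => shuffle R (enum_val j)).

Lemma gen_shuffles q (t : 'S_q) :
  gen (range (fun j : 'I_#|{: 'S_q}| => shuffle R (enum_val j))) (shuffle R t).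
Proof. by apply: sub_generated; exists (enum_rank t) => //; rewrite enum_rankK. Qed.

Lemma shuffle_rotation_group q (t : 'S_q) : rotation_group q (shuffle R t).
Proof.
by apply: sub_generated; right; exists (enum_rank t) => //; rewrite enum_rankK.
Qed.

(** Modulo [1/q], the map [f] is the rotation by [k * r]. *)
Definition base_rotation q (f : iet R) (k : int) : Prop :=
  forall x : ico R, q%:R * (val (f x) - val x - r * k%:~R) \is a Num.int.

Lemma base_rotationM q f g k l : base_rotation q f k -> base_rotation q g l ->
  base_rotation q (f * g)%g (k + l).
Proof.
move=> fk gl x; rewrite intrD /=.
rewrite (_ : q%:R * _ = q%:R * (val (f (g x)) - val (g x) - r * k%:~R) +
  q%:R * (val (g x) - val x - r * l%:~R)); last by rewrite /=; ring.
by rewrite rpredD.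
Qed.

Lemma base_rotationV q f k : base_rotation q f k -> base_rotation q f^-1%g (- k).
Proof.
move=> fk x; have := fk ((f^-1)%g x); rewrite iet_mulKV => fx.
rewrite -rpredN (_ : - (q%:R * _) = q%:R *
  (val x - val ((f^-1)%g x) - r * k%:~R)) // intrN /=; ring.
Qed.

Lemma base_rotation1 q : base_rotation q 1%g 0.
Proof. by move=> x; rewrite mulr0 subr0 subrr mulr0 rpred0. Qed.

Lemma base_rotationX q f k n : base_rotation q f k ->
  base_rotation q (f ^+ n)%g (k *+ n).
Proof.
move=> fk; elim: n => [|n IHn]; first exact: base_rotation1.
by rewrite expgS mulrS; exact: base_rotationM.
Qed.

Lemma base_rotation_ex q f : (0 < q)%N -> rotation_group q f ->
  exists k, base_rotation q f k.
Proof.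
move=> q0; suff : rotation_group q `<=`
  [set f | exists k, base_rotation q f k] by apply.
apply: gen_min.
  apply/subgroupP; split; first by exists 0; exact: base_rotation1.
  move=> h g [k hk] [l gl]; exists (k - l).
  by apply: base_rotationM => //; exact: base_rotationV.
have q0' : q%:R != 0 :> R by rewrite pnatr_eq0 -lt0n.
move=> _ [[_ _ <-]|[j _ <-]].
  exists 1 => x; rewrite rotationE /Defs.frac mulr1.
  set n := Num.floor _; rewrite (_ : _ - _ = - n%:~R); last by ring.
  by rewrite rpredM ?rpredN ?intr_int ?natr_int.
exists 0 => x; have [i xi] := piece_ex q0 (valP x).
rewrite /= (shuffle_valE _ xi) mulr0 subr0 addrAC subrr add0r mulrC divfK //.
by rewrite rpredB ?natr_int.
Qed.

(** A point of the base interval is determined by its class modulo [1/q], so a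
    map that is the identity modulo [1/q] preserves every fibre. *)
Lemma base_rotation0_fibred q f : (0 < q)%N -> base_rotation q f 0 ->
  exists phi : R -> 'S_q, fibred f phi.
Proof.
move=> q0 f0; suff : forall y, exists c : 'S_q,
    0 <= y < q%:R^-1 -> fibre_action y f c.
  by move=> /choice[phi phiP]; exists phi.
move=> y; case: (boolP (0 <= y < q%:R^-1)) => [hy|_]; last by exists 1%g.
have q0' : 0 < q%:R :> R by rewrite ltr0n.
have /choice[c cP] (i : 'I_q) : exists j : 'I_q,
    val (f (fibre_point hy i)) = y + j%:R / q%:R.
  have [u /andP[u0 u1] [j uj]] := fibre_ex (f (fibre_point hy i)) q0.
  exists j; rewrite uj; congr (_ + _).
  have /= := f0 (fibre_point hy i); rewrite uj mulr0 subr0.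
  rewrite (_ : _ * _ = q%:R * (u - y) + (j%:R - i%:R)); last first.
    by field; rewrite gt_eqF.
  rewrite rpredDr ?rpredB ?natr_int // => /intrP[z uz].
  have /andP[y0 y1] := hy.
  (* [q (u - y)] is an integer of absolute value less than 1. *)
  have z_small : (-1 : R) < (z%:~R : R) < (1 : R).
    rewrite -!uz mulrC; apply/andP; split.
      by rewrite -ltr_pdivrMr // mulN1r; lra.
    by rewrite -ltr_pdivlMr // mul1r; lra.
  have z0 : z = 0 by move: z_small; rewrite -[-1]/((-1)%:~R) ltr_int ltrz1; lia.
  move/eqP: uz; rewrite z0 mulf_eq0 gt_eqF //= subr_eq0 => /eqP //.
have c_inj : injective c.
  move=> i j cij; apply: (@fibre_inj R q y).
  have : f (fibre_point hy i) = f (fibre_point hy j).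
    by apply: val_inj; rewrite !cP cij.
  move=> /(congr1 (f^-1)%g); rewrite !iet_mulVK => /(congr1 val) //.
exists (perm c_inj) => _ i x xi; rewrite permE -cP; congr (val (f _)).
exact: val_inj.
Qed.

Lemma fibre_actionX q (y : R) f (c : 'S_q) n :
  fibre_action y f c -> fibre_action y (f ^+ n)%g (c ^+ n)%g.
Proof.
move=> fc; elim: n => [|n IHn]; first by rewrite !expg0; exact: fibre_action1.
by rewrite expgS expgSr; exact: fibre_actionM.
Qed.

(** An element of finite order induces on the base a rotation of finite order by
    a multiple of the irrational [r], hence the identity. It therefore permutes
    each fibre, and a permutation of [q < p] points has no order [p]. *)
Lemma rotation_group_no_torsion q p : (0 < q)%N -> prime p -> (q < p)%N ->
  ~ has_torsion p (rotation_group q).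
Proof.
move=> q0 p_pr qp [f [Hf f1 fp]]; apply: f1.
have [k fk] := base_rotation_ex q0 Hf.
(* [f ^+ p] is the identity and induces the rotation by [p * k * r]. *)
have k0 : k = 0.
  have h01 : 0 <= (0 : R) < 1 by rewrite lexx ltr01.
  have := base_rotationX p fk (exist _ 0 h01).
  rewrite fp /= subrr sub0r mulrN rpredN.
  rewrite (_ : q%:R * _ = r * (k *+ p *+ q)%:~R); last by rewrite !rmorphMn /=; ring.
  move=> /r_irr /eqP; rewrite -mulrnA mulrn_eq0 muln_eq0.
  by rewrite !eqn0Ngt q0 (prime_gt0 p_pr) => /eqP.
move: fk; rewrite k0 => /(base_rotation0_fibred q0)[phi fphi].
apply: (fibred_inj q0 fphi); apply: (fibred_ext (@fibred1 R q)) => y hy.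
have : (phi y ^+ p = 1)%g.
  apply: (fibre_action_uniq hy _ (@fibre_action1 R q y)).
  by rewrite -fp; apply: fibre_actionX; exact: fphi.
move=> /eqP; rewrite -order_dvdn => /(primeP p_pr).2 /orP[|/eqP pE].
  by rewrite order_eq1 => /eqP.
have : (p %| #|'Sym_('I_q)|)%N by rewrite -pE order_dvdG ?inE.
rewrite card_Sym card_ord => p_fact.
have : forall n, (p %| n`!)%N -> (p <= n)%N.
  elim=> [|n IHn]; first by rewrite fact0 dvdn1 => /eqP p1; rewrite p1 in p_pr.
  rewrite factS Euclid_dvdM // => /orP[/dvdn_leq ->//|/IHn /leqW //].
by move=> /(_ _ p_fact); rewrite leqNgt qp.
Qed.

Lemma shuffle1 q : shuffle R (1 : 'S_q)%g = 1%g.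
Proof.
by apply: (mulgI (shuffle R (1 : 'S_q)%g)); rewrite -shuffleM !mulg1.
Qed.

Lemma shuffleX q (t : 'S_q) n : shuffle R (t ^+ n)%g = (shuffle R t ^+ n)%g.
Proof.
elim: n => [|n IHn]; first by rewrite !expg0 shuffle1.
by rewrite expgSr shuffleM IHn expgS.
Qed.

(** By Cauchy's theorem, since [p] divides the order [p!] of the symmetric
    group. *)
Lemma rotation_group_torsion p : prime p -> has_torsion p (rotation_group p).
Proof.
move=> p_pr; have [|t _ tp] := @Cauchy _ p 'Sym_('I_p) p_pr.
  by rewrite card_Sym card_ord dvdn_fact // prime_gt0 /=.
exists (shuffle R t); split; first exact: shuffle_rotation_group.
  rewrite -(shuffle1 p) => /shuffle_inj t1.
  by have := prime_gt1 p_pr; rewrite -tp t1 order1.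
have tp1 : (t ^+ p = 1)%g by apply/eqP; rewrite -order_dvdn tp.
by rewrite -shuffleX tp1 shuffle1.
Qed.

Lemma rotation_group_not_isomorphic p q : prime p -> prime q -> p != q ->
  ~ isomorphic (rotation_group p) (rotation_group q).
Proof.
move=> p_pr q_pr pq iso.
have sP : subgroup (rotation_group p) by exact: subgroup_gen.
case: (ltngtP p q) pq => // [pq _|qp _].
  by case: (rotation_group_no_torsion (prime_gt0 p_pr) q_pr pq);
    apply/(isomorphic_torsion q sP iso)/rotation_group_torsion.
by case: (rotation_group_no_torsion (prime_gt0 q_pr) p_pr qp);
  apply/(isomorphic_torsion p sP iso)/rotation_group_torsion.
Qed.

End Torsion.

(** * Prime degrees *)

Lemma infinite_unbounded (A : set nat) :
  (forall n, exists2 m, (n < m)%N & A m) -> infinite_set A.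
Proof.
move=> Aunb /finite_seqP[s As]; have [m sm] := Aunb (\max_(i <- s) i)%N.
rewrite As /= => ms; have := @leq_bigmax_seq _ s predT id m ms isT.
by rewrite leqNgt sm.
Qed.

Theorem proposition8p10 (R : realType) :
  (forall (s m q : nat) (alpha : 'I_s -> circle R) (g : 'I_m -> iet R),
     (1 <= s)%N -> (1 <= m)%N -> (5 <= q)%N ->
     (forall i, irrational_mod1 (alpha i)) ->
     Q_independent alpha ->
     (forall j, shuffles q (g j)) ->
     (perms_of q (gen (range g)) = [set: 'S_q] \/
      perms_of q (gen (range g)) = [set t | (t \in 'Alt_('I_q))%g]) ->
     [/\ subgroup (Hgroup alpha g),
         infinite_set (Hgroup alpha g),
         finitely_generated (Hgroup alpha g),
         ~ virtually_solvable (Hgroup alpha g)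
       & ~ linear_group (Hgroup alpha g)])
  /\
  (exists C : set (set (iet R)),
     [/\ infinite_set C,
         forall H, C H ->
           [/\ subgroup H, infinite_set H, finitely_generated H,
               ~ virtually_solvable H & ~ linear_group H]
       & forall H H', C H -> C H' -> H <> H' -> ~ isomorphic H H']).
Proof.
split.
  move=> s m q alpha g s1 _ q5 a_irr _ _ Qq.
  apply: (@Hgroup_properties R s m q) => // t tA.
  by case: Qq => /seteqP[_ /(_ t)]; apply.
have [r r_irr] := irrational_ex R.
pose P : set nat := [set p | prime p && (5 <= p)%N].
have P_inf : infinite_set P.
  apply: infinite_unbounded => n; have [p np p_pr] := prime_above (n + 5).
  by exists p; [lia|rewrite /P /= p_pr; lia].
have noniso p p' : P p -> P p' -> p != p' ->
    ~ isomorphic (rotation_group r p) (rotation_group r p').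
  by move=> /andP[? _] /andP[? _]; exact: rotation_group_not_isomorphic.
have props p : P p -> [/\ subgroup (rotation_group r p),
    infinite_set (rotation_group r p), finitely_generated (rotation_group r p),
    ~ virtually_solvable (rotation_group r p)
    & ~ linear_group (rotation_group r p)].
  move=> /andP[_ p5]; apply: (@Hgroup_properties R 1 _ p) => // [_|t _].
    exact: multiple_irrational_mod1.
  exact: gen_shuffles.
exists (rotation_group r @` P); split.
- move=> C_fin; apply: P_inf;
  rewrite -(eq_finite_set (@inj_card_eq _ _ P (rotation_group r) _)) //.
  move=> p p' /set_mem Pp /set_mem Pp' pp'.
  apply/eqP/negPn/negP => /(noniso _ _ Pp Pp').
  by rewrite pp'; apply; exact: isomorphic_refl.
- by move=> _ [p Pp <-]; exact: props.
- move=> _ _ [p Pp <-] [p' Pp' <-] pp'; apply: noniso => //.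
  by apply/eqP => e; apply: pp'; rewrite e.
Qed.
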